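(* Let $x^0\in\mathbb{R}^n$ and let $S=[s^1\ s^2\ \cdots\ s^n]\in\mathbb{R}^{n\times n}$. Define $U_0=S$ and, for $\ell\in\{1,\dots,n\}$, $$U_\ell=[\,s^1-s^\ell\ \ s^2-s^\ell\ \cdots\ s^{\ell-1}-s^\ell\ \ -s^\ell\ \ s^{\ell+1}-s^\ell\ \cdots\ s^n-s^\ell\,]\in\mathbb{R}^{n\times n}.$$ Then for each $\ell\in\{0,1,\dots,n\}$, $|\mathcal{S}(x^0;S,U_\ell)|\le (n+1)(n+2)/2$. Moreover, if $S$ has full rank, then $|\mathcal{S}(x^0;S,U_\ell)|=(n+1)(n+2)/2$ for each $\ell\in\{0,1,\dots,n\}$.
   Context: For $S=[s^1\cdots s^m]\in\mathbb{R}^{n\times m}$ and $\overline{T}=[t^1\cdots t^k]\in\mathbb{R}^{n\times k}$, $\mathcal{S}(x^0;S,\overline{T})$ denotes the set of all distinct points at which the function is evaluated when computing the generalized simplex Hessian $\nabla_s^2 f(x^0;S,\overline{T})$, that is, $$\mathcal{S}(x^0;S,\overline{T})=\{x^0\}\cup\{x^0+s^i\}_{i}\cup\{x^0+t^j\}_{j}\cup\{x^0+s^i+t^j\}_{i,j},\quad i\in\{1,\dots,m\},\ j\in\{1,\dots,k\}.$$ $|\cdot|$ denotes cardinality. *)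

(* Defs.v *)
From mathcomp Require Import all_boot all_order all_algebra.
From mathcomp Require Import finmap reals.
Set Implicit Arguments.
Unset Strict Implicit.
Unset Printing Implicit Defensive.
Import Order.TTheory GRing.Theory Num.Theory.
Local Open Scope fset_scope.
Local Open Scope ring_scope.

(* Points of R^n are column vectors; the s^i and t^j are the columns of S and T. *)
Definition eval_points (R : realType) (n m k : nat) (x0 : 'cV[R]_n)
    (S : 'M[R]_(n, m)) (T : 'M[R]_(n, k)) : {fset 'cV[R]_n} :=
  [fset x0]
  `|` [fset x0 + col i S | i in 'I_m]
  `|` [fset x0 + col j T | j in 'I_k]
  `|` [fset x0 + col i S + col j T | i in 'I_m, j in 'I_k].

(* The index l ranges over {0, ..., n}. Since the columns of S are indexed by
   'I_n, i.e. from 0, the value l = p + 1 stands for the column p of S. *)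
Definition U_matrix (R : realType) (n : nat) (S : 'M[R]_n) (l : 'I_n.+1) :
    'M[R]_n :=
  match unlift ord0 l with
  | None => S
  | Some p =>
      \matrix_(i, j) (if j == p then - S i p else S i j - S i p)
  end.

(* Main.v *)
(* Put w_0 = 0 and w_i = s^i. Up to one zero vector, the columns of U_l are the
   differences w_b - w_l, so the evaluation points are exactly the
   x^0 - w_l + (w_a + w_b) with 0 <= a, b <= n. They are indexed by unordered
   pairs {a, b}, of which there are (n+1)(n+2)/2. If S is invertible, w_a + w_b
   determines the multiplicity of every nonzero index in {a, b}, hence {a, b}
   itself. *)
Require Import Defs.
From mathcomp Require Import all_boot all_order all_algebra.
From mathcomp Require Import finmap reals.
Set Implicit Arguments.
Unset Strict Implicit.
Unset Printing Implicit Defensive.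
Import Order.TTheory GRing.Theory Num.Theory.
Local Open Scope fset_scope.
Local Open Scope ring_scope.

(** These are the vectors [w_a]; the shift of indices by one is the one that [U_matrix] applies to
    [l]. *)
Definition col_or_zero (R : realType) (n : nat) (S : 'M[R]_n) (a : 'I_n.+1) :
    'cV[R]_n :=
  if unlift ord0 a is Some i then col i S else 0.

Lemma col_or_zero_lift (R : realType) (n : nat) (S : 'M[R]_n) (i : 'I_n) :
  col_or_zero S (lift ord0 i) = col i S.
Proof. by rewrite /col_or_zero liftK. Qed.

Lemma col_or_zero0 (R : realType) (n : nat) (S : 'M[R]_n) :
  col_or_zero S ord0 = 0.
Proof. by rewrite /col_or_zero unlift_none. Qed.

(** Factoring [S] out on the left lets an invertible [S] be cancelled later; the indicator vector
    vanishes for [a = ord0]. *)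
Lemma col_or_zero_mulmx (R : realType) (n : nat) (S : 'M[R]_n) (a : 'I_n.+1) :
  col_or_zero S a = S *m \col_i (a == lift ord0 i)%:R.
Proof.
case: (unliftP ord0 a) => [i ->|->].
  rewrite col_or_zero_lift colE; congr (_ *m _); apply/matrixP => k j.
  by rewrite !mxE (inj_eq lift_inj) [j]ord1 eqxx andbT eq_sym.
rewrite col_or_zero0 [X in _ *m X](_ : _ = 0) ?mulmx0 //.
by apply/matrixP => k j; rewrite !mxE -(inj_eq val_inj).
Qed.

Lemma col_U_matrix (R : realType) (n : nat) (S : 'M[R]_n) (l : 'I_n.+1)
    (j : 'I_n) :
  exists b, col j (U_matrix S l) = col_or_zero S b - col_or_zero S l.
Proof.
rewrite /U_matrix; case: unliftP => [p ->|->].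
  (* The exceptional column [- s^p] is [w_0 - w_l]. *)
  exists (if j == p then ord0 else lift ord0 j).
  rewrite col_or_zero_lift; apply/matrixP => k z; rewrite !mxE.
  by case: (j == p); rewrite ?col_or_zero0 ?col_or_zero_lift !mxE ?sub0r.
by exists (lift ord0 j); rewrite col_or_zero_lift col_or_zero0 subr0.
Qed.

(** The case [b = l] is excluded because the zero vector need not be a column of [U_l]. *)
Lemma sub_col_or_zero_U_matrix (R : realType) (n : nat) (S : 'M[R]_n)
    (l b : 'I_n.+1) :
  b != l ->
  exists j, col_or_zero S b - col_or_zero S l = col j (U_matrix S l).
Proof.
rewrite /U_matrix; case: (unliftP ord0 l) => [p ->|->] bl; last first.
  case: (unliftP ord0 b) bl => [j ->|->] // _.
  by exists j; rewrite col_or_zero_lift col_or_zero0 subr0.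
case: (unliftP ord0 b) bl => [j ->|->] bl.
  exists j; rewrite !col_or_zero_lift; apply/matrixP => k z; rewrite !mxE.
  by rewrite -(inj_eq (@lift_inj _ ord0)) (negPf bl).
exists p; rewrite col_or_zero_lift col_or_zero0; apply/matrixP => k z.
by rewrite !mxE eqxx sub0r.
Qed.

(** An unordered pair with repetition is represented by its sorted form. *)
Definition le_pairs (n : nat) : {set 'I_n.+1 * 'I_n.+1} :=
  [set p : 'I_n.+1 * 'I_n.+1 | (p.1 <= p.2)%N].

(** Count by the larger entry [b], which leaves [b + 1] choices for the smaller one. *)
Lemma card_le_pairs (n : nat) : #|le_pairs n| = (((n + 1) * (n + 2)) %/ 2)%N.
Proof.
rewrite -sum1_card (eq_bigl (fun p : 'I_n.+1 * 'I_n.+1 => (p.1 <= p.2)%N)) => [|p]; last first.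
  by rewrite inE.
rewrite -(pair_big_dep xpredT (fun a b : 'I_n.+1 => (a <= b)%N)
  (fun _ _ => 1%N)) (exchange_big_dep xpredT) //=.
transitivity (\sum_(b < n.+1) b.+1)%N; last first.
  have := bin2_sum n.+2; rewrite big_nat_recl // add0n big_mkord => ->.
  by rewrite bin2 -divn2 !addnS addn0 mulnC.
apply: eq_bigr => b _.
by rewrite -(big_ord_widen _ (fun=> 1%N) (ltn_ord b)) sum1_card card_ord.
Qed.

Definition pair_point (R : realType) (n : nat) (x0 : 'cV[R]_n) (S : 'M[R]_n)
    (l : 'I_n.+1) (p : 'I_n.+1 * 'I_n.+1) : 'cV[R]_n :=
  x0 - col_or_zero S l + (col_or_zero S p.1 + col_or_zero S p.2).

Lemma eval_points_pair_point (R : realType) (n : nat) (x0 : 'cV[R]_n)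
    (S : 'M[R]_n) (l : 'I_n.+1) :
  eval_points x0 S (U_matrix S l) =
    [fset pair_point x0 S l p | p in le_pairs n].
Proof.
have pointE a b : x0 + col_or_zero S a + (col_or_zero S b - col_or_zero S l) =
    pair_point x0 S l (a, b).
  by rewrite (addrC (col_or_zero S b)) addrACA.
have mem_pair a b :
    pair_point x0 S l (a, b) \in [fset pair_point x0 S l p | p in le_pairs n].
  case: (leqP a b) => ab.
    by apply/imfsetP; exists (a, b); rewrite //= inE.
  apply/imfsetP; exists (b, a); first by rewrite /= inE /= ltnW.
  by rewrite /pair_point /= [in RHS](addrC (col_or_zero S b)).
apply/fsetP => y; apply/idP/idP.
  case/fsetUP => [/fsetUP[/fsetUP[]|]|].
  (* Choosing [l] as second index cancels [- w_l], which yields [x0] and the points [x0 + s^i]. *)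
  - rewrite inE => /eqP ->.
    have := mem_pair ord0 l.
    by rewrite -pointE col_or_zero0 subrr !addr0.
  - case/imfsetP => i _ ->; have := mem_pair (lift ord0 i) l.
    by rewrite -pointE col_or_zero_lift subrr addr0.
  - case/imfsetP => j _ ->; have [b ->] := col_U_matrix S l j.
    by have := mem_pair ord0 b; rewrite -pointE col_or_zero0 addr0.
  - case/imfset2P => i _ [j _ ->]; have [b ->] := col_U_matrix S l j.
    by have := mem_pair (lift ord0 i) b; rewrite -pointE col_or_zero_lift.
case/imfsetP => -[a b] _ ->; rewrite -pointE.
(* For [b = l] the point is [x0 + w_a], which needs no column of [U_l]. *)
have [->|/(sub_col_or_zero_U_matrix S)[j ->]] := eqVneq b l.
  rewrite subrr addr0; case: (unliftP ord0 a) => [i ->|->].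
    rewrite col_or_zero_lift; do 2 (apply/fsetUP; left).
    by apply/fsetUP; right; apply/imfsetP; exists i.
  by rewrite col_or_zero0 addr0; do 3 (apply/fsetUP; left); rewrite inE.
case: (unliftP ord0 a) => [i ->|->].
  rewrite col_or_zero_lift; apply/fsetUP; right.
  by apply/imfset2P; exists i => //; exists j.
rewrite col_or_zero0 addr0; apply/fsetUP; left; apply/fsetUP; right.
by apply/imfsetP; exists j.
Qed.

(** If the maxima differed, the larger one would be positive and absent from the other pair. Once
    the maxima are cancelled, the same argument applies to the minima. *)
Lemma le_pair_multiplicity_inj (a b c d : nat) :
  (a <= b)%N -> (c <= d)%N ->
  (forall j, 0 < j -> (a == j) + (b == j) = (c == j) + (d == j))%N ->
  a = c /\ b = d.
Proof.
move=> ab cd mult.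
have bd : b = d.
  have [bd|db|//] := ltngtP b d.
    move: (mult d (leq_ltn_trans (leq0n b) bd)).
    by rewrite (ltn_eqF bd) (ltn_eqF (leq_ltn_trans ab bd)) eqxx addnS.
  move: (mult b (leq_ltn_trans (leq0n d) db)).
  by rewrite (ltn_eqF db) (ltn_eqF (leq_ltn_trans cd db)) eqxx addnS.
split=> //; move: mult; rewrite bd => mult.
have [ac|ca|//] := ltngtP a c.
  move/addIn: (mult c (leq_ltn_trans (leq0n a) ac)).
  by rewrite (ltn_eqF ac) eqxx.
move/addIn: (mult a (leq_ltn_trans (leq0n c) ca)).
by rewrite (ltn_eqF ca) eqxx.
Qed.

Lemma pair_point_inj (R : realType) (n : nat) (x0 : 'cV[R]_n) (S : 'M[R]_n)
    (l : 'I_n.+1) :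
  \rank S = n -> {in le_pairs n &, injective (pair_point x0 S l)}.
Proof.
move=> rkS [a b] [c d]; rewrite !inE /= => ab cd /addrI.
rewrite !col_or_zero_mulmx -!mulmxDr.
have uS : S \in unitmx by rewrite -row_full_unit /row_full rkS.
move=> /(can_inj (mulKmx uS)) /matrixP eqD.
have mult j : (0 < j)%N ->
    ((a == j :> nat) + (b == j :> nat) =
     (c == j :> nat) + (d == j :> nat))%N.
  (* Row [j] of the vector equation counts the index [j + 1]. For [j >= n] this exceeds every index,
     so both counts are zero. *)
  case: j => // j _; have [jn|nj] := ltnP j n; last first.
    by rewrite !ltn_eqF // (leq_trans (ltn_ord _)).
  (* Counts that agree in [R] agree as natural numbers. *)
  move: (eqD (Ordinal jn) ord0); rewrite !mxE -!natrD => /eqP.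
  by rewrite eqr_nat -!(inj_eq val_inj) /= => /eqP.
have [ac bd] := le_pair_multiplicity_inj ab cd mult.
by congr pair; apply: val_inj.
Qed.

Theorem proposition5p3 (R : realType) (n : nat) (x0 : 'cV[R]_n)
    (S : 'M[R]_n) :
  (forall l : 'I_n.+1,
     (#|` eval_points x0 S (U_matrix S l)| <= ((n + 1) * (n + 2)) %/ 2)%N) /\
  (\rank S = n ->
   forall l : 'I_n.+1,
     #|` eval_points x0 S (U_matrix S l)| = (((n + 1) * (n + 2)) %/ 2)%N).
Proof.
split=> [l|rkS l]; rewrite eval_points_pair_point -card_le_pairs.
  apply: leq_trans (leq_imfset_card _ _ _) _.
  by rewrite cardE.
rewrite card_in_imfset /= ?cardE //.
exact: pair_point_inj rkS.
Qed.
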